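(* (1) Every perfect tract that is not near-idempotent is excellent. (2) Every degenerate tract is excellent. (3) The Krasner hyperfield $\mathbb K$ and the tropical hyperfield $\mathbb T_0$ are excellent.
   Context: Tract: commutative monoid $F$ with absorbing $0$, $F^\times=F\setminus\{0\}$ a group, null set $N_F$ an ideal of $\mathbb N[F^\times]$ (contains $0$, closed under sums and multiplication by $\mathbb N[F^\times]$) such that each $a$ has a unique $-a$ with $a+(-a)\in N_F$. Near-idempotent: $1+1\in N_F$ and $1+1+x\in N_F$ for some $x\in F^\times$. Degenerate: every formal sum with at least three nonzero terms lies in $N_F$. $\mathbb K=\{0,1\}$ with a formal sum null iff the number of nonzero terms is not exactly one; $\mathbb T_0=\mathbb R_{\ge0}$ with usual multiplication and a formal sum null iff all terms are $0$ or the maximum is attained at least twice. For M-convex $J\subseteq\Delta^r_n$ (nonempty, exchange property), with $\delta^\mp_J$ the componentwise min/max, $\bar J=J-\delta^-_J$, $\bar r=r-|\delta^-_J|$, $\omega_J=\delta^+_J-\delta^-_J$, $\Sigma\boldsymbol\beta=\sum_m\epsilon_{\beta_m}$: a weak $F$-representation is an alternating $\rho\colon[n]^{\bar r}\to F$ with $\rho(\boldsymbol\beta)\ne0\iff\Sigma\boldsymbol\beta\in\bar J$ satisfying $\rho(\boldsymbol\alpha jk)\rho(\boldsymbol\alpha il)-\rho(\boldsymbol\alpha ik)\rho(\boldsymbol\alpha jl)+\rho(\boldsymbol\alpha ij)\rho(\boldsymbol\alpha kl)\in N_F$ whenever $\boldsymbol\alpha\in[n]^{\bar r-2}$, $\Sigma(\boldsymbol\alpha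 ijkl)\le\omega_J$; it is strong if moreover $\sum_{k=0}^s(-1)^k\rho(\boldsymbol\alpha i_0\dots\widehat{i_k}\dots i_s)\rho(\boldsymbol\alpha i_kj_2\dots j_s)\in N_F$ for all $2\le s\le\bar r$, $\boldsymbol\alpha\in[n]^{\bar r-s}$ and indices with $\Sigma(\boldsymbol\alpha i_0\dots i_sj_2\dots j_s)\le\omega_J$. $F$ is excellent if every weak $F$-representation of every M-convex set is strong. Perfect tracts: for a matroid $M$ of rank $r$ on $[n]$ (viewed as an M-convex subset of $\{0,1\}^n$) and a strong $F$-representation $\varphi\colon[n]^r\to F$, define for $x\in[n]^{r-1}$ the function $D_x(e)=\varphi(x_1,\dots,x_{r-1},e)$ and for $y\in[n]^{r+1}$ with distinct entries the function $C_y$ with $C_y(y_k)=(-1)^k\varphi(y_1,\dots,\widehat{y_k},\dots,y_{r+1})$ and $C_y(e)=0$ for $e\notin\{y_1,\dots,y_{r+1}\}$. A vector of $\varphi$ is $X\in F^n$ with $\sum_eX(e)D_x(e)\in N_F$ for all $x$; a covector is $Y\in F^n$ with $\sum_eY(e)C_y(e)\in N_F$ for all $y$. $F$ is perfect if for every matroid and every strong $F$-representation of it, $\sum_eX(e)Y(e)\in N_F$ for all vectors $X$ and covectors $Y$. *)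

(* Defs.v *)
From mathcomp Require Import all_boot.
From Stdlib Require Import Reals Permutation.

Set Implicit Arguments.
Unset Strict Implicit.
Unset Printing Implicit Defensive.

(* A formal sum in N[F^x] is encoded as a list of elements of F; entries *)
(* equal to 0 are the empty sum (they are ignored, see [null_zero]), and *)
(* the order is irrelevant (see [null_perm]).  [neg a] is the unique -a. *)
Record tract_data := TractData {
  carrier :> Type;
  tzero : carrier;
  tone : carrier;
  tmul : carrier -> carrier -> carrier;
  tneg : carrier -> carrier;
  tnull : seq carrier -> Prop
}.
Arguments tnull : clear implicits.

Definition is_tract (F : tract_data) : Prop :=
  (forall a b c : F, tmul a (tmul b c) = tmul (tmul a b) c) /\
  (forall a b : F, tmul a b = tmul b a) /\
  (forall a : F, tmul (tone F) a = a) /\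
  (forall a : F, tmul (tzero F) a = tzero F) /\
  tone F <> tzero F /\
  (forall a b : F, a <> tzero F -> b <> tzero F -> tmul a b <> tzero F) /\
  (forall a : F, a <> tzero F -> exists b, tmul a b = tone F) /\
  tnull F [::] /\
  (* formal sums are commutative *)
  (forall s t : seq F, Permutation s t -> tnull F s -> tnull F t) /\
  (* zero terms are the zero of N[F^x] *)
  (forall s : seq F, tnull F (tzero F :: s) <-> tnull F s) /\
  (forall s t : seq F, tnull F s -> tnull F t -> tnull F (s ++ t)) /\
  (* closed under multiplication by elements of N[F^x] *)
  (forall s t : seq F, tnull F s -> tnull F (allpairs (@tmul F) t s)) /\
  (forall a b : F, tnull F [:: a; b] <-> b = tneg a).

Definition tsign (F : tract_data) (k : nat) (x : F) : F := iter k (@tneg F) x.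

Definition near_idempotent (F : tract_data) : Prop :=
  tnull F [:: tone F; tone F] /\
  exists x : F, x <> tzero F /\ tnull F [:: tone F; tone F; x].

Definition degenerate (F : tract_data) : Prop :=
  forall s : seq F, (forall x, List.In x s -> x <> tzero F) -> 3 <= size s -> tnull F s.

(* M-convex sets.  Elements of Delta^r_n are encoded as finite functions *)
(* 'I_n -> 'I_r.+1 (coordinates are <= r) whose coordinate sum is r.     *)
Definition Mconvex (n r : nat) (J : {set {ffun 'I_n -> 'I_r.+1}}) : Prop :=
  [/\ J != set0,
      (forall a, a \in J -> \sum_(i < n) (a i : nat) = r) &
      (forall a b i, a \in J -> b \in J -> (b i < a i)%N ->
         exists j, [/\ (a j < b j)%N,
           (exists2 a', a' \in J &
              forall k, (a' k : nat) + (k == i) = a k + (k == j)) &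
           (exists2 b', b' \in J &
              forall k, (b' k : nat) + (k == j) = b k + (k == i))])].

Section MconvexDefs.
Variables (n r : nat) (J : {set {ffun 'I_n -> 'I_r.+1}}).

Definition dmin (i : 'I_n) : nat := \big[minn/r]_(a in J) (a i : nat).
Definition dmax (i : 'I_n) : nat := \big[maxn/0]_(a in J) (a i : nat).
Definition omega (i : 'I_n) : nat := dmax i - dmin i.
Definition rbar : nat := r - \sum_(i < n) dmin i.

Definition inJbar (beta : seq 'I_n) : bool :=
  [exists a in J, [forall e, (a e : nat) == count_mem e beta + dmin e]].

Definition le_omega (beta : seq 'I_n) : Prop :=
  forall e, count_mem e beta <= omega e.

Variable F : tract_data.

(* rho is a function [n]^{\bar r} -> F, encoded as a function on lists;   *)
(* only its values on lists of length \bar r matter.                      *)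
Definition alternating (rho : seq 'I_n -> F) : Prop :=
  forall (a : seq 'I_n) x b y c,
    size (a ++ x :: b ++ y :: c) = rbar ->
    rho (a ++ x :: b ++ y :: c) = tneg (rho (a ++ y :: b ++ x :: c)).

Definition weak_rep (rho : seq 'I_n -> F) : Prop :=
  [/\ alternating rho,
      (forall beta, size beta = rbar -> (rho beta <> tzero F <-> inJbar beta)) &
      (forall (alpha : seq 'I_n) i j k l,
         size alpha + 2 = rbar ->
         le_omega (alpha ++ [:: i; j; k; l]) ->
         tnull F [:: tmul (rho (alpha ++ [:: j; k])) (rho (alpha ++ [:: i; l]));
                     tneg (tmul (rho (alpha ++ [:: i; k])) (rho (alpha ++ [:: j; l])));
                     tmul (rho (alpha ++ [:: i; j])) (rho (alpha ++ [:: k; l]))])].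

Definition strong_rep (rho : seq 'I_n -> F) : Prop :=
  weak_rep rho /\
  forall (s : nat) (alpha : seq 'I_n) (i : 'I_s.+1 -> 'I_n) (js : seq 'I_n),
    (2 <= s <= rbar)%N ->
    size alpha + s = rbar ->
    size js = s.-1 ->
    le_omega (alpha ++ [seq i m | m <- enum 'I_s.+1] ++ js) ->
    tnull F [seq tsign k
               (tmul (rho (alpha ++ [seq i m | m <- enum 'I_s.+1 & m != k]))
                     (rho (alpha ++ i k :: js)))
            | k : 'I_s.+1 <- enum 'I_s.+1].

End MconvexDefs.

Definition excellent (F : tract_data) : Prop :=
  forall (n r : nat) (J : {set {ffun 'I_n -> 'I_r.+1}}),
    Mconvex J -> forall rho : seq 'I_n -> F, weak_rep J rho -> strong_rep J rho.

Definition matroid (n r : nat) (J : {set {ffun 'I_n -> 'I_r.+1}}) : Prop :=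
  Mconvex J /\ forall a, a \in J -> forall i, (a i <= 1)%N.

Section Perfect.
Variables (F : tract_data) (n r : nat) (J : {set {ffun 'I_n -> 'I_r.+1}}).
Variable phi : seq 'I_n -> F.

Definition Dfun (x : seq 'I_n) (e : 'I_n) : F := phi (x ++ [:: e]).
(* C_y(y_k) = (-1)^k phi(y_1..^y_k..y_{r+1}), k 1-based *)
Definition Cfun (y : seq 'I_n) (e : 'I_n) : F :=
  if e \in y then tsign (index e y).+1 (phi (rem e y)) else tzero F.

Definition is_vector (X : 'I_n -> F) : Prop :=
  forall x : seq 'I_n, size x + 1 = rbar J ->
    tnull F [seq tmul (X e) (Dfun x e) | e <- enum 'I_n].

Definition is_covector (Y : 'I_n -> F) : Prop :=
  forall y : seq 'I_n, size y = (rbar J).+1 -> uniq y ->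
    tnull F [seq tmul (Y e) (Cfun y e) | e <- enum 'I_n].
End Perfect.

Definition perfect (F : tract_data) : Prop :=
  forall (n r : nat) (J : {set {ffun 'I_n -> 'I_r.+1}}),
    matroid J -> forall phi : seq 'I_n -> F, strong_rep J phi ->
    forall X Y : 'I_n -> F, is_vector J phi X -> is_covector J phi Y ->
      tnull F [seq tmul (X e) (Y e) | e <- enum 'I_n].

Definition Krasner : tract_data :=
  @TractData bool false true andb (fun b : bool => b) (fun s => count (fun b : bool => b) s != 1%N).

Definition Rnn := {x : R | Rle 0 x}.
Definition Rnn0 : Rnn := exist _ 0%R (Rle_refl 0%R).
Definition Rnn1 : Rnn := exist _ 1%R Rle_0_1.
Definition Rnn_mul (x y : Rnn) : Rnn :=
  exist _ (proj1_sig x * proj1_sig y)%R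
    (Rmult_le_pos _ _ (proj2_sig x) (proj2_sig y)).

Definition trop_null (s : seq Rnn) : Prop :=
  (forall x, List.In x s -> proj1_sig x = 0%R) \/
  exists p q : nat, [/\ p <> q, (p < size s)%N, (q < size s)%N,
    proj1_sig (nth Rnn0 s p) = proj1_sig (nth Rnn0 s q) &
    forall x, List.In x s -> Rle (proj1_sig x) (proj1_sig (nth Rnn0 s p))].

Definition Tropical : tract_data :=
  @TractData Rnn Rnn0 Rnn1 Rnn_mul (fun x : Rnn => x) trop_null.

(* Main.v *)
Require Import Defs.
From mathcomp Require Import all_boot.
From Stdlib Require Import Permutation ClassicalEpsilon.
From Stdlib Require List.
From Stdlib Require Import Reals Lra.
From mathcomp Require Import zify.

Set Implicit Arguments.
Unset Strict Implicit.
Unset Printing Implicit Defensive.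

(** All the cases reduce to one orthogonality statement in rank 2
    ([rank2_perfect] below).  The Pluecker relation with parameters [s+1],
    [alpha], [i_0 .. i_(s+1)], [j_2 :: js] reads [\sum_k X k * Y k = 0] with
    [X k = (-1)^k rho (alpha, i without i_k)] and [Y k = rho (alpha, i_k, j_2, js)].
    Put [psi a b = +- rho (alpha, j_2, i without i_a and i_b)], the dual of the
    contraction by [alpha, j_2] restricted to the [i_k]: a rank 2 object on the
    index set ['I_s.+2].  The three-term relations of [rho] say that [psi] is
    Pluecker and that [X] is a covector of [psi]; the relations with parameter
    [s] say that [Y] is a vector of [psi].  If some term is nonzero, exchange
    gives [psi <> 0], so induction on [s] works as soon as vectors and covectors
    of rank 2 are orthogonal.  Working on indices [k] instead of elements [i_k]
    makes repeated elements harmless, so general M-convex sets cost no more than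
    matroids.

    Orthogonality in rank 2 is perfection applied to the rank 2 matroid of [psi]
    (coloops, which [rbar] removes, being treated by hand), and is checked
    directly for degenerate tracts and for the tropical hyperfield. *)

Local Notation "x *' y" := (tmul x y) (at level 40, left associativity).
Local Notation "-' x" := (tneg x) (at level 35, right associativity).

(** * Arithmetic of tracts and of their null sums *)

Section TractTheory.
Variables (F : tract_data) (HF : is_tract F).
Notation zero := (tzero F).
Notation one := (tone F).
Notation null := (tnull F).
Implicit Types (x y z : F) (s t : seq F).

Lemma tmulA x y z : x *' (y *' z) = (x *' y) *' z.
Proof. by case: HF. Qed.
Lemma tmulC x y : x *' y = y *' x.
Proof. by case: HF => _ []. Qed.
Lemma tmul1 x : one *' x = x.
Proof. by case: HF => _ [_ []]. Qed.
Lemma tmul0 x : zero *' x = zero.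
Proof. by case: HF => _ [_ [_ []]]. Qed.
Lemma tmulr0 x : x *' zero = zero.
Proof. by rewrite tmulC tmul0. Qed.
Lemma tmul_neq0 x y : x <> zero -> y <> zero -> x *' y <> zero.
Proof. case: HF => _ [_ [_ [_ [_ [h _]]]]]; exact: h. Qed.
Lemma tinv x : x <> zero -> exists y, y *' x = one.
Proof.
case: HF => _ [_ [_ [_ [_ [_ [h _]]]]]] /h [y xy].
by exists y; rewrite tmulC.
Qed.
Lemma null_nil : null [::].
Proof. by case: HF => _ [_ [_ [_ [_ [_ [_ []]]]]]]. Qed.
Lemma null_perm s t : Permutation s t -> null s -> null t.
Proof. case: HF => _ [_ [_ [_ [_ [_ [_ [_ [h _]]]]]]]]; exact: h. Qed.
Lemma null0 s : null (zero :: s) <-> null s.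
Proof. by case: HF => _ [_ [_ [_ [_ [_ [_ [_ [_ [h _]]]]]]]]]. Qed.
Lemma null_scale x s : null s -> null [seq x *' y | y <- s].
Proof.
case: HF => _ [_ [_ [_ [_ [_ [_ [_ [_ [_ [_ [h _]]]]]]]]]]] /(h _ [:: x]).
by rewrite /= cats0.
Qed.
Lemma null2 x y : null [:: x; y] <-> y = -' x.
Proof. by case: HF => _ [_ [_ [_ [_ [_ [_ [_ [_ [_ [_ [_ h]]]]]]]]]]]. Qed.

Lemma tmul_eq0 x y : x *' y = zero -> x <> zero -> y = zero.
Proof. by move=> xy x0; case: (classic (y = zero)) => // y0; case: (tmul_neq0 x0 y0). Qed.
Lemma tmulCA x y z : x *' (y *' z) = y *' (x *' z).
Proof. by rewrite !tmulA (tmulC x). Qed.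

Lemma tnegK x : -' (-' x) = x.
Proof.
apply: esym; apply/null2.
have h : null [:: x; -' x] by apply/null2.
exact: null_perm (perm_swap _ _ _) h.
Qed.
Lemma tmulN x y : x *' -' y = -' (x *' y).
Proof. apply/null2; exact: (@null_scale x [:: y; -' y] (proj2 (null2 _ _) erefl)). Qed.
Lemma tmulNl x y : -' x *' y = -' (x *' y).
Proof. by rewrite tmulC tmulN tmulC. Qed.
Lemma tneg0 : -' zero = zero.
Proof. by apply: esym; apply/null2/null0/null0/null_nil. Qed.
Lemma tneg_eq0 x : -' x = zero -> x = zero.
Proof. by move=> e; rewrite -(tnegK x) e tneg0. Qed.

Lemma null1 x : null [:: x] -> x = zero.
Proof. by move=> h; rewrite -tneg0; apply/null2/null0. Qed.

Lemma null_scaleI x s : x <> zero -> null [seq x *' y | y <- s] -> null s.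
Proof.
case/tinv => u ux /(null_scale u); rewrite -map_comp.
congr null; rewrite -[RHS]map_id; apply: eq_map => y /=.
by rewrite tmulA ux tmul1.
Qed.

Lemma null_opp s : null [seq -' y | y <- s] <-> null s.
Proof.
have h t : null t -> null [seq -' y | y <- t].
  move=> /(null_scale (-' one)); congr null.
  by apply: eq_map => y; rewrite tmulNl tmul1.
split; last exact: h.
move/h; rewrite -map_comp; congr null.
by rewrite -[RHS]map_id; apply: eq_map => y /=; rewrite tnegK.
Qed.

Lemma tsignE k x : tsign k x = if odd k then -' x else x.
Proof. by elim: k => //= k ->; case: (odd k); rewrite //= tnegK. Qed.

(** Signs indexed by booleans, so that composing signs is xor. By [tsignE], [tsign k] is
    [sg (odd k)]. *)
Definition sg (b : bool) x := if b then -' x else x.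

Lemma sgM b x y : sg b x *' y = sg b (x *' y).
Proof. by case: b; rewrite //= tmulNl. Qed.
Lemma sgMr b x y : x *' sg b y = sg b (x *' y).
Proof. by case: b; rewrite //= tmulN. Qed.
Lemma sg_sg b c x : sg b (sg c x) = sg (b (+) c) x.
Proof. by case: b; case: c; rewrite //= tnegK. Qed.
Lemma sg_opp b x : -' sg b x = sg (~~ b) x.
Proof. by case: b; rewrite //= tnegK. Qed.
Lemma null_sg b s : null [seq sg b y | y <- s] <-> null s.
Proof. case: b => /=; [exact: null_opp | by rewrite map_id]. Qed.
Lemma sg_eq0 b x : sg b x = zero -> x = zero.
Proof. by case: b => //; exact: tneg_eq0. Qed.

Lemma perm_eq_Permutation (T : eqType) (s t : seq T) : perm_eq s t -> Permutation s t.
Proof.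
elim: s t => [|x s ih] t; first by move/perm_size/esym/size0nil->.
move=> e; have xt : x \in t by rewrite -(perm_mem e) mem_head.
case/splitPr: xt e => p q.
rewrite perm_sym -[x :: q]cat1s perm_catCA perm_cons perm_sym => /ih e.
exact: Permutation_cons_app.
Qed.

Lemma null_perm_map (T : eqType) (h : T -> F) (s t : seq T) :
  perm_eq s t -> null (map h s) -> null (map h t).
Proof. by move/perm_eq_Permutation/(Permutation_map h); exact: null_perm. Qed.

Lemma null_map0 (T : eqType) (h : T -> F) (p : pred T) (s : seq T) :
  {in s, forall e, ~~ p e -> h e = zero} ->
  null (map h s) <-> null (map h (filter p s)).
Proof.
have cat0 u v : null (v ++ zero :: u) <-> null (v ++ u).
  have e : Permutation (zero :: (v ++ u)) (v ++ zero :: u) by apply: Permutation_middle.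
  by split=> [/(null_perm (Permutation_sym e))/null0 | /null0/(null_perm e)].
move=> h0; rewrite -[map h s]cat0s -[map h (filter p s)]cat0s.
(* [null0] removes a zero only at the head, so the induction carries the prefix [v] already
   scanned. *)
move: [::] => v; elim: s v h0 => //= x s ih v h0.
case: (boolP (p x)) => px /=.
  rewrite -[v ++ h x :: map h s]cat_rcons -[v ++ h x :: _]cat_rcons.
  by apply: ih => e es; apply: h0; rewrite inE es orbT.
rewrite h0 ?mem_head // cat0; apply: ih => e es; apply: h0.
by rewrite inE es orbT.
Qed.

Lemma null_supp (T : finType) (h : T -> F) (s : seq T) :
  uniq s -> (forall e, e \notin s -> h e = zero) ->
  null (map h (enum T)) <-> null (map h s).
Proof.
move=> us h0; rewrite (@null_map0 _ h [in s]); last by move=> e _; exact: h0.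
have e : perm_eq (filter [in s] (enum T)) s.
  apply: uniq_perm => //; first by rewrite filter_uniq ?enum_uniq.
  by move=> x; rewrite mem_filter mem_enum andbT.
by split; apply: null_perm_map; rewrite // perm_sym.
Qed.

Lemma null_all0 (T : eqType) (h : T -> F) (s : seq T) :
  (forall e, h e = zero) -> null (map h s).
Proof.
move=> h0; apply/(@null_map0 _ h pred0); first by move=> e _ _.
by rewrite filter_pred0; exact: null_nil.
Qed.

(** The carrier has no decidable equality; this boolean lets supports be filtered and collected into
    finite sets. *)
Definition nz x : bool := if excluded_middle_informative (x = zero) then false else true.

Lemma nzP x : reflect (x <> zero) (nz x).
Proof. by rewrite /nz; case: excluded_middle_informative => h; constructor. Qed.

End TractTheory.

(** * Vectors and covectors in rank 2 *)

(** [psi] plays the part of a rank 2 Grassmann-Plücker function on ['I_m], with covector [X] and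
    vector [Y]; the letters are exchanged with respect to [perfect]. *)
Record rank2_pair (F : tract_data) (m : nat) (psi : 'I_m -> 'I_m -> F) (X Y : 'I_m -> F) : Prop :=
  Rank2Pair {
    psi_diag : forall a, psi a a = tzero F;
    psi_anti : forall a b, psi b a = -' psi a b;
    psi_plucker : forall a b c d, uniq [:: a; b; c; d] ->
      tnull F [:: psi b c *' psi a d; -' (psi a c *' psi b d); psi a b *' psi c d];
    covector3 : forall a b c, uniq [:: a; b; c] ->
      tnull F [:: X a *' psi b c; -' (X b *' psi a c); X c *' psi a b];
    vector1 : forall a, tnull F [seq Y e *' psi a e | e <- enum 'I_m]
  }.

Arguments psi_diag {F m psi X Y}.
Arguments psi_anti {F m psi X Y}.
Arguments psi_plucker {F m psi X Y}.
Arguments covector3 {F m psi X Y}.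
Arguments vector1 {F m psi X Y}.

Definition rank2_perfect (F : tract_data) : Prop :=
  forall m (psi : 'I_m -> 'I_m -> F) X Y, rank2_pair psi X Y ->
    (exists a b, psi a b <> tzero F) -> tnull F [seq X e *' Y e | e <- enum 'I_m].

Section Rank2.
Variables (F : tract_data) (HF : is_tract F) (m : nat).
Variables (psi : 'I_m -> 'I_m -> F) (X Y : 'I_m -> F) (P : rank2_pair psi X Y).
Notation zero := (tzero F).

(** A covector relation with one vanishing term has two terms left, which must be opposite. On
    triples with a repetition, [psi_diag] and [psi_anti] give the same equality. *)
Lemma covector3_eq l e c : X l *' psi e c = zero -> X c *' psi l e = X e *' psi l c.
Proof.
move=> h; case: (eqVneq e c) => [->//|ec].
case: (eqVneq l e) => [le|le].
  by subst e; rewrite h (psi_diag P) tmulr0.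
case: (eqVneq l c) => [lc|lc].
  by subst l; rewrite (psi_diag P) (tmulr0 HF) (psi_anti P) (tmulN HF) h tneg0.
have := @covector3 _ _ _ _ _ P l e c.
rewrite /= !inE negb_or le lc ec h => /(_ isT)/(null0 HF)/(null2 HF) ->.
by rewrite tnegK.
Qed.

(* [X c] times the vector relation at [l] is [psi l c] times the sum
   [\sum_e X e * Y e], as soon as the relevant covector relations have only
   two terms. *)
Lemma psi_eq0_of_binary c l :
  ~ tnull F [seq X e *' Y e | e <- enum 'I_m] -> X c <> zero ->
  (forall e, Y e <> zero -> X l *' psi e c = zero) -> psi l c = zero.
Proof.
move=> nXY Xc h; case: (classic (psi l c = zero)) => // plc; case: nXY.
apply: (null_scaleI HF plc).
have := null_scale HF (X c) (vector1 P l).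
rewrite -!map_comp; congr tnull; apply: eq_map => e /=.
rewrite [LHS](tmulCA HF) [RHS](tmulCA HF).
case: (classic (Y e = zero)) => [->|/h/covector3_eq ->]; first by rewrite !(tmulr0, tmul0).
by rewrite (tmulCA HF) (tmulC HF (Y e)) -(tmulCA HF) (tmulC HF (psi l c)).
Qed.

(** Two of the three terms of the covector relation on [a], [b], [c] contain some [psi l c], so the
    third, [X c *' psi a b], vanishes too. *)
Lemma psi_eq0_of_loop c : X c <> zero -> (forall l, psi l c = zero) ->
  forall a b, psi a b = zero.
Proof.
move=> Xc h a b; apply: (tmul_eq0 HF _ Xc).
by rewrite covector3_eq h ?tmulr0.
Qed.

Lemma psi_eq0_off_support c l : ~ tnull F [seq X e *' Y e | e <- enum 'I_m] ->
  X c <> zero -> X l = zero -> psi l c = zero.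
Proof. by move=> n Xc Xl; apply: psi_eq0_of_binary => // e _; rewrite Xl tmul0. Qed.

End Rank2.

(** * Degenerate tracts *)

(** If the sum of the [X e *' Y e] is not null, degeneracy confines its support to some [c] and [d].
    The vector relation at [c] then reduces to the term of [d], so [psi c d] vanishes. This makes
    the covector relations that matter binary, [c] becomes a loop, and [psi] is zero. *)
Lemma degenerate_rank2_perfect (F : tract_data) :
  is_tract F -> degenerate F -> rank2_perfect F.
Proof.
move=> HF dF m psi X Y P [a [b pab]].
apply: NNPP => nXY; apply: pab.
set p := fun e => nz (X e *' Y e).
have XY0 e : ~~ p e -> X e <> tzero F -> Y e = tzero F.
  by move/nzP/NNPP/(tmul_eq0 HF).
have : ~ tnull F [seq X e *' Y e | e <- enum 'I_m & p e].
  by move=> h; apply: nXY; apply/(@null_map0 _ HF _ _ p) => // e _ /nzP/NNPP.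
move=> n; case Es : (filter p (enum 'I_m)) n => [|c s] n; first by case: n; exact: null_nil.
have ps e : p e = (e \in c :: s) by rewrite -Es mem_filter mem_enum andbT.
(* When the support is the single point [c], the witness is [d = c]. *)
have [d ds cs] : exists2 d, d \in c :: s & {subset c :: s <= [:: c; d]}.
  case: s Es ps n => [|d [|d' s]] Es ps n; first by exists c => [|e]; rewrite !inE ?eqxx ?orbb.
    by exists d; rewrite // !inE eqxx orbT.
  case: n; apply: dF; last by rewrite size_map.
  move=> x; rewrite -Es => /List.in_map_iff [e [<- h']].
  apply/nzP; rewrite -/(p e) ps -Es.
  elim: (filter p _) h' => //= y t ih [->|/ih]; rewrite inE ?eqxx // => ->.
  by rewrite orbT.
have Xn e : p e -> X e <> tzero F by move/nzP => h X0; apply: h; rewrite X0 tmul0.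
have pc : p c by rewrite ps mem_head.
have pd : p d by rewrite ps.
have Xc := Xn c pc.
have Yn e : Y e <> tzero F -> X e <> tzero F -> e = c \/ e = d.
  move=> Ye Xe; have : p e by apply/nzP; apply: tmul_neq0.
  by rewrite ps => /cs; rewrite !inE => /orP[]/eqP; [left | right].
have pdc : psi d c = tzero F.
  have Yd : Y d <> tzero F by move/nzP: pd => h Y0; apply: h; rewrite Y0 tmulr0.
  rewrite (psi_anti P) (_ : psi c d = tzero F) ?(tneg0 HF) //.
  apply: (tmul_eq0 HF _ Yd); apply: (null1 HF).
  apply/(@null_supp _ HF _ (fun e => Y e *' psi c e) [:: d]) => //; last exact: (vector1 P).
  move=> e; rewrite inE => /eqP ed.
  case: (classic (Y e = tzero F)) => [->|Ye]; first by rewrite tmul0.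
  case: (classic (X e = tzero F)) => [Xe|Xe].
    by rewrite (psi_anti P) (psi_eq0_off_support HF P nXY) // tneg0 // tmulr0.
  by case: (Yn e Ye Xe) => // ->; rewrite (psi_diag P) tmulr0.
apply: (psi_eq0_of_loop HF P Xc) => l.
apply: (psi_eq0_of_binary HF P nXY Xc) => e Ye.
case: (classic (X e = tzero F)) => Xe.
  by rewrite (psi_eq0_off_support HF P nXY) // tmulr0.
by case: (Yn e Ye Xe) => ->; rewrite ?pdc ?(psi_diag P) tmulr0.
Qed.

(** * Perfect tracts: the rank 2 matroid of [psi] *)

Lemma dmin_le n r (J : {set {ffun 'I_n -> 'I_r.+1}}) a i : a \in J -> dmin J i <= a i.
Proof.
move=> aJ; rewrite /dmin; elim: (index_enum _) (mem_index_enum a) => // b s ih.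
rewrite inE big_cons => /orP[/eqP <-|/ih h]; first by rewrite aJ geq_minl.
by case: ifP => // _; rewrite geq_min h orbT.
Qed.

Section PerfectRank2.
Variables (F : tract_data) (HF : is_tract F) (m : nat).
Variables (psi : 'I_m -> 'I_m -> F) (X Y : 'I_m -> F) (P : rank2_pair psi X Y).
Notation zero := (tzero F).

Definition pair_point (a b : 'I_m) : {ffun 'I_m -> 'I_3} :=
  [ffun e => inord ((e == a) + (e == b))].

Definition psi_bases : {set {ffun 'I_m -> 'I_3}} :=
  [set v | [exists a, [exists b, nz (psi a b) && (v == pair_point a b)]]].

(** The default [zero] is harmless: only lists of length [rbar psi_bases], which will be 2,
    matter. *)
Definition psi_list (l : seq 'I_m) : F := if l is [:: a; b] then psi a b else zero.

Lemma pair_pointE a b e : pair_point a b e = (e == a) + (e == b) :> nat.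
Proof. by rewrite ffunE inordK //; case: (e == a); case: (e == b). Qed.

Lemma psi_basesP v :
  reflect (exists a b, psi a b <> zero /\ v = pair_point a b) (v \in psi_bases).
Proof.
rewrite inE; apply: (iffP existsP) => [[a /existsP[b /andP[/nzP h /eqP ->]]]|].
  by exists a, b.
by case=> a [b [/nzP h ->]]; exists a; apply/existsP; exists b; rewrite h eqxx.
Qed.

Lemma psi_neq a b : psi a b <> zero -> a != b.
Proof. by move=> h; apply/eqP => ab; apply: h; rewrite ab (psi_diag P). Qed.

Lemma psi_sym_neq0 a b : psi a b <> zero -> psi b a <> zero.
Proof. by rewrite (psi_anti P a b) => h /(tneg_eq0 HF). Qed.

(** The product [psi a b *' psi c d] is a nonzero term of a Plücker relation. A null sum cannot have
    exactly one nonzero term, so one of the other two products is nonzero as well. *)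
Lemma psi_exchange a b c d : psi a b <> zero -> psi c d <> zero ->
  a != c -> a != d ->
  (psi c b <> zero /\ psi a d <> zero) \/ (psi d b <> zero /\ psi a c <> zero).
Proof.
move=> ab cd ac ad; have nab := psi_neq ab; have ncd := psi_neq cd.
case: (eqVneq b c) => [bc|bc].
  by subst c; right; split=> //; apply: psi_sym_neq0.
case: (eqVneq b d) => [bd|bd]; first by subst d; left.
apply: NNPP => /not_or_and [h1 h2]; apply: (tmul_neq0 HF ab cd).
have := psi_plucker P a b c d.
rewrite /= !inE !negb_or nab ac ad bc bd ncd => /(_ isT).
have -> : psi b c *' psi a d = zero.
  case: (classic (psi b c = zero)) => [->|h]; first by rewrite tmul0.
  case: (classic (psi a d = zero)) => [->|h']; first by rewrite tmulr0.
  by case: h1; split=> //; apply: psi_sym_neq0.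
have -> : psi a c *' psi b d = zero.
  case: (classic (psi a c = zero)) => [->|h]; first by rewrite tmul0.
  case: (classic (psi b d = zero)) => [->|h']; first by rewrite tmulr0.
  by case: h2; split=> //; apply: psi_sym_neq0.
by rewrite tneg0 // => /(null0 HF)/(null0 HF)/(null1 HF).
Qed.

Lemma pair_pointC a b : pair_point a b = pair_point b a.
Proof. by apply/ffunP => e; rewrite !ffunE addnC. Qed.

Lemma psi_Mconvex : (exists a b, psi a b <> zero) -> Mconvex psi_bases.
Proof.
move=> [a0 [b0 h0]]; split.
- by apply/set0Pn; exists (pair_point a0 b0); apply/psi_basesP; exists a0, b0.
- move=> v /psi_basesP[a [b [_ ->]]].
  under eq_bigr do rewrite pair_pointE.
  by rewrite big_split /= -!big_mkcond !big_pred1_eq.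
move=> v w i /psi_basesP[a [b [ab ->]]] /psi_basesP[c [d [cd ->]]] lt.
(* The coordinate at [i] is positive, so [i] is one of [a], [b]; by symmetry it may be listed
   first. *)
have [b' ib ->] : exists2 b', psi i b' <> zero & pair_point a b = pair_point i b'.
  case: (eqVneq i a) => [->|ia]; first by exists b.
  case: (eqVneq i b) => [->|ib]; first by exists a; [exact: psi_sym_neq0 | exact: pair_pointC].
  by move: lt; rewrite !pair_pointE (negPf ia) (negPf ib).
have [ic id] : i != c /\ i != d.
  move: lt; rewrite !pair_pointE; case: (i == c); case: (i == d) => //=;
    by case: eqP => // ia; case: eqP => // ib'; case/negP: (psi_neq ab); rewrite -ia -ib'.
(* Exchanging [c] and [d] swaps the two alternatives of [psi_exchange]; after this [c] is the
   element traded for [i]. *)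
wlog [cb di] : c d cd lt ic id / psi c b' <> zero /\ psi i d <> zero.
  move=> h; case: (psi_exchange ib cd ic id) => h'; first exact: h.
  rewrite [pair_point c d]pair_pointC; apply: h => //; first exact: psi_sym_neq0.
  by rewrite [pair_point d c]pair_pointC.
have := psi_neq cb; have := psi_neq cd; move=> ncd ncb.
exists c; split.
- by rewrite !pair_pointE eqxx eq_sym (negPf ic) (negPf ncb).
- exists (pair_point c b'); first by apply/psi_basesP; exists c, b'.
  by move=> k; rewrite !pair_pointE; do 3!case: eqP => _.
- exists (pair_point i d); first by apply/psi_basesP; exists i, d.
  by move=> k; rewrite !pair_pointE; do 3!case: eqP => _.
Qed.

(** The last hypothesis excludes coloops: every element is avoided by some basis. Hence [dmin] is
    zero, [rbar] is 2, and [perfect] can be applied to [psi_list] itself. *)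
Lemma psi_rank2_perfect : perfect F -> (exists a b, psi a b <> zero) ->
  (forall a, exists b c, [/\ b != a, c != a & psi b c <> zero]) ->
  tnull F [seq X e *' Y e | e <- enum 'I_m].
Proof.
move=> perfF ex nocoloop; have JM := psi_Mconvex ex.
have J1 v i : v \in psi_bases -> v i <= 1.
  case/psi_basesP=> a [b [/psi_neq ab ->]]; rewrite pair_pointE.
  by case: eqP => [->|_]; rewrite ?(negPf ab) //; case: eqP.
have dmin0 e : dmin psi_bases e = 0.
  case: (nocoloop e) => b [c [be ce bc]].
  apply/eqP; rewrite -leqn0.
  have h : pair_point b c \in psi_bases by apply/psi_basesP; exists b, c.
  by have := dmin_le e h; rewrite pair_pointE ![e == _]eq_sym (negPf be) (negPf ce).
have rb : rbar psi_bases = 2 by rewrite /rbar big1.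
have om e : omega psi_bases e <= 1.
  rewrite /omega dmin0 subn0 /dmax.
  by apply: (big_ind (fun k => k <= 1)) => // [x y hx hy|v]; [rewrite geq_max hx | exact: J1].
have uniq_le l : le_omega psi_bases l -> uniq l.
  move=> h; apply: count_mem_uniq => e.
  have := leq_trans (h e) (om e); rewrite -has_pred1 has_count.
  by case: (count _ l) => [|[|]].
have inJ a b : psi a b <> zero <-> inJbar psi_bases [:: a; b].
  split=> [ab|].
    apply/existsP; exists (pair_point a b); apply/andP; split.
      by apply/psi_basesP; exists a, b.
    apply/forallP => e; rewrite pair_pointE dmin0 /= !addn0.
    by rewrite ![e == _]eq_sym.
  case/existsP=> v /andP[/psi_basesP[c [d [cd ->]]] /forallP h].
  have {}h e : (e == c) + (e == d) = (a == e) + (b == e).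
    by have /eqP := h e; rewrite pair_pointE dmin0 /= !addn0.
  have ncd := psi_neq cd.
  have hc : (a == c) || (b == c) by have := h c; rewrite eqxx; case: (a == c); case: (b == c).
  have hd : (a == d) || (b == d).
    by have := h d; rewrite eqxx [d == c]eq_sym (negPf ncd); case: (a == d); case: (b == d).
  case/orP: hc => /eqP e1; case/orP: hd => /eqP e2; subst.
  - by rewrite eqxx in ncd.
  - by [].
  - exact: psi_sym_neq0.
  - by rewrite eqxx in ncd.
have wk : weak_rep psi_bases psi_list.
  split.
  - move=> a x b y c; rewrite rb !size_cat /= !size_cat /=.
    case: a => [|? a]; case: b => [|? b]; case: c => [|? c]; rewrite /= ?addnS //= => _.
    exact: (psi_anti P).
  - by move=> [|a [|b [|]]]; rewrite rb // => _; exact: inJ.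
  - move=> al i j k l; rewrite rb -[in RHS](add0n 2) => /addIn/size0nil -> /uniq_le /=.
    exact: (psi_plucker P).
have st : strong_rep psi_bases psi_list.
  split=> // s al i js; rewrite rb => hs.
  (* In rank 2 the only strong relation has [s = 2], and it is the three-term relation again. *)
  have {hs} s2 : s = 2 by apply/eqP; rewrite eqn_leq andbC.
  subst s; rewrite -[in RHS](add0n 2) => /addIn/size0nil -> {al}.
  case: js => [|j [|]] //= _ /uniq_le.
  rewrite !enum_ordSl enum_ord0 /= tnegK //.
  exact: (psi_plucker P).
have := @perfF _ _ _ (conj JM (fun v vJ i => J1 v i vJ)) _ st Y X.
have eXY : [seq Y e *' X e | e <- enum 'I_m] = [seq X e *' Y e | e <- enum 'I_m].
  by apply: eq_map => e; rewrite tmulC.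
rewrite eXY; apply.
- move=> x; rewrite rb addn1 => -[]; case: x => [|a [|]] //= _.
  exact: (vector1 P).
- move=> y; rewrite rb; case: y => [|a [|b [|c [|]]]] //= _ u.
  apply/(@null_supp _ HF _ _ [:: a; b; c]) => //.
    by move=> e; rewrite /Cfun => /negPf ->; rewrite tmulr0.
  move: (u); rewrite /= !inE negb_or => /andP[/andP[ab ac] /andP[bc _]].
  have ba : b != a by rewrite eq_sym.
  have ca : c != a by rewrite eq_sym.
  have cb : c != b by rewrite eq_sym.
  have E := (negPf ab, negPf ac, negPf bc, negPf ba, negPf ca, negPf cb, eqxx).
  rewrite /Cfun /= !inE ?E /= ?E /=.
  rewrite !tnegK // !tmulN //.
  (* With 1-based indices [C_y] carries the signs [-, +, -], the opposite of those in
     [covector3]. *)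
  have := covector3 P a b c u.
  by move/(null_opp HF); rewrite /= tnegK.
Qed.

End PerfectRank2.

(** It remains to treat a coloop [a], where [psi b c] vanishes unless [a] is [b] or [c]. A vector
    relation then has the single term of [a], so [Y a] is zero. If the sum were not null, some [c]
    other than [a] would have [X c] nonzero; the relations at [a] are binary, so [c] would be a loop
    and [psi] zero. *)
Lemma perfect_rank2_perfect (F : tract_data) : is_tract F -> perfect F -> rank2_perfect F.
Proof.
move=> HF perfF m psi X Y P ex.
case: (classic (forall a, exists b c, [/\ b != a, c != a & psi b c <> tzero F])).
  exact: psi_rank2_perfect.
move=> /not_all_ex_not [a coloop]; apply: NNPP => nXY.
have pa b c : b != a -> c != a -> psi b c = tzero F.
  by move=> ba ca; apply: NNPP => h; apply: coloop; exists b, c.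
have [b ba pb] : exists2 b, b != a & psi b a <> tzero F.
  case: ex => b [c bc]; case: (eqVneq b a) => ba.
    subst b; exists c; last exact: (psi_sym_neq0 HF P).
    by rewrite eq_sym; exact: (psi_neq P).
  exists b => //; case: (eqVneq c a) => [<- //|ca].
  by case: bc; exact: pa.
have Ya : Y a = tzero F.
  apply: (tmul_eq0 HF _ pb); rewrite tmulC //; apply: (null1 HF).
  apply/(@null_supp _ HF _ (fun e => Y e *' psi b e) [:: a]) => //; last exact: (vector1 P).
  by move=> e; rewrite inE => ea; rewrite pa // tmulr0.
have [c ca Xc] : exists2 c, c != a & X c <> tzero F.
  apply: NNPP => n; apply: nXY; apply: null_all0 => // e.
  case: (eqVneq e a) => [->|ea]; first by rewrite Ya tmulr0.
  by case: (classic (X e = tzero F)) => [->|Xe]; [rewrite tmul0 | case: n; exists e].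
apply: pb; apply: (psi_eq0_of_loop HF P Xc) => l.
case: (eqVneq l a) => [->|la]; last exact: pa.
apply: (psi_eq0_of_binary HF P nXY Xc) => e Ye.
by rewrite pa ?tmulr0 //; apply/eqP => ea; apply: Ye; rewrite ea.
Qed.

(** * The tropical hyperfield *)

Lemma Rnn_eq (x y : Rnn) : sval x = sval y -> x = y.
Proof.
case: x y => [x hx] [y hy] /= e; subst y.
by rewrite (proof_irrelevance _ hx hy).
Qed.

Lemma Rnn_ge0 (x : Rnn) : (0 <= sval x)%R.
Proof. exact: proj2_sig x. Qed.

Lemma Permutation_nth2 (T : Type) (x0 : T) (s : seq T) p q : p < q -> q < size s ->
  exists s', Permutation s (nth x0 s p :: nth x0 s q :: s').
Proof.
have one (t : seq T) k : k < size t -> exists t', Permutation t (nth x0 t k :: t').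
  elim: t k => // x t ih [|k] /= hk; first by exists t.
  have [t' e] := ih k hk; exists (x :: t').
  exact: perm_trans (perm_skip x e) (perm_swap _ _ _).
elim: s p q => // x s ih [|p] [|q] //= pq qs.
  by have [s' e] := one s q qs; exists s'; apply: perm_skip.
have [s' e] := ih p q pq qs; exists (x :: s').
apply: perm_trans (perm_skip x e) _.
apply: perm_trans (perm_swap _ _ _) _.
by apply: perm_skip; exact: perm_swap.
Qed.

(** A form of [trop_null] without positions: an upper bound [v] that is zero or attained by two
    entries brought to the front. Permutations, scaling and sums are easy to follow in this form. *)
Lemma trop_nullP (s : seq Rnn) : trop_null s <->
  exists v : R, (forall x, List.In x s -> (sval x <= v)%R) /\
    (v = 0%R \/ exists a b s', [/\ Permutation s (a :: b :: s'), sval a = v & sval b = v]).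
Proof.
split.
  case=> [h|[p [q [pq ps qs e h]]]].
    by exists 0%R; split; [move=> x /h ->; lra | left].
  exists (sval (nth Rnn0 s p)); split=> //; right.
  case: (ltngtP p q) => // lt.
    have [s' es] := Permutation_nth2 Rnn0 lt qs.
    by exists (nth Rnn0 s p), (nth Rnn0 s q), s'.
  have [s' es] := Permutation_nth2 Rnn0 lt ps.
  by exists (nth Rnn0 s q), (nth Rnn0 s p), s'.
case=> v [hv [v0|[a [b [s' [es av bv]]]]]].
  by left=> x /hv; have := Rnn_ge0 x; lra.
right.
have /(@List.in_split _ a s)[l1 [l2 E]] : List.In a s.
  by apply: (Permutation_in _ (Permutation_sym es)); left.
have P2 : Permutation (b :: s') (l1 ++ l2).
  by apply: (@Permutation_cons_app_inv _ _ _ _ a); rewrite -E; exact: Permutation_sym.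
have : List.In b (l1 ++ l2) by apply: (Permutation_in _ P2); left.
move/(@List.in_app_or _ l1 l2 b)/or_comm; case.
  case/(@List.in_split _ b l2)=> m1 [m2 E2]; subst l2; rewrite {}E in hv *.
  exists (size l1), (size (l1 ++ a :: m1)).
  have -> : nth Rnn0 (l1 ++ a :: m1 ++ b :: m2) (size l1) = a by rewrite nth_cat ltnn subnn.
  have -> : nth Rnn0 (l1 ++ a :: m1 ++ b :: m2) (size (l1 ++ a :: m1)) = b.
    by rewrite -cat_cons catA nth_cat ltnn subnn.
  by rewrite !size_cat /= !size_cat /= av bv; split=> //; lia.
case/(@List.in_split _ b l1)=> m1 [m2 E2]; subst l1; rewrite {}E in hv *.
exists (size (m1 ++ b :: m2)), (size m1).
have -> : nth Rnn0 ((m1 ++ b :: m2) ++ a :: l2) (size (m1 ++ b :: m2)) = a.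
  by rewrite nth_cat ltnn subnn.
have -> : nth Rnn0 ((m1 ++ b :: m2) ++ a :: l2) (size m1) = b.
  by rewrite -catA nth_cat ltnn subnn.
by rewrite !size_cat /= av bv; split=> //; lia.
Qed.

Lemma trop_scale x s : trop_null s -> trop_null [seq Rnn_mul x y | y <- s].
Proof.
move=> /trop_nullP[v [hv h]]; apply/trop_nullP; exists (sval x * v)%R; split.
  move=> z /List.in_map_iff [y [<- /hv le]] /=.
  by apply: Rmult_le_compat_l => //; exact: Rnn_ge0.
case: h => [->|[a [b [s' [e av bv]]]]]; first by left; rewrite Rmult_0_r.
right; exists (Rnn_mul x a), (Rnn_mul x b), [seq Rnn_mul x y | y <- s'].
split; [exact: (Permutation_map (Rnn_mul x) e) | by rewrite /= av | by rewrite /= bv].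
Qed.

Lemma trop_perm s t : Permutation s t -> trop_null s -> trop_null t.
Proof.
move=> e /trop_nullP[u [hu h1]]; apply/trop_nullP; exists u; split.
  by move=> x /(Permutation_in x (Permutation_sym e)); exact: hu.
case: h1 => [|[a [b [s' [e' av bv]]]]]; [by left | right; exists a, b, s'].
by split=> //; exact: perm_trans (Permutation_sym e) e'.
Qed.

Lemma trop_cat s t : trop_null s -> trop_null t -> trop_null (s ++ t).
Proof.
move=> /trop_nullP[v [hv h]] /trop_nullP[w [hw h']].
(* The larger of the two bounds serves for the concatenation. *)
wlog le : s t v w hv h hw h' / (w <= v)%R.
  move=> H; case: (Rle_or_lt w v) => [|/Rlt_le] le; first exact: (H s t v w).
  by apply: (@trop_perm (t ++ s)); [exact: Permutation_app_comm | exact: (H t s w v)].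
apply/trop_nullP; exists v; split.
  move=> x /(@List.in_app_or _ s t x)[/hv //|/hw hx]; exact: Rle_trans hx le.
case: h => [|[a [b [s' [e av bv]]]]]; [by left | right; exists a, b, (s' ++ t)].
by split=> //; exact: (Permutation_app_tail t e).
Qed.

Lemma tropical_tract : is_tract Tropical.
Proof.
have t0 (s : seq Rnn) : trop_null (Rnn0 :: s) <-> trop_null s.
  split=> /trop_nullP[v [hv h]]; apply/trop_nullP; exists v.
    split; first by move=> x xs; apply: hv; right.
    case: h => [|[a [b [s' [e av bv]]]]]; first by left.
    (* If [v] is nonzero, the deleted zero is neither of the two entries of value [v], so it lies in
       [s']. *)
    case: (Req_dec v 0) => [|v0]; first by left.
    have : List.In Rnn0 (a :: b :: s') by apply: (Permutation_in _ e); left.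
    case=> [a0|[b0|]]; first by case: v0; rewrite -av a0.
      by case: v0; rewrite -bv b0.
    move/(@List.in_split _ Rnn0 s') => [l1 [l2 E]]; right; exists a, b, (l1 ++ l2).
    split=> //; apply: (@Permutation_cons_app_inv _ _ (a :: b :: l1) l2 Rnn0).
    by rewrite /= -E.
  split.
    move=> x [<-|/hv //] /=.
    by case: h => [->|[a [b [s' [e <- bv]]]]]; [exact: Rle_refl | exact: Rnn_ge0].
  case: h => [|[a [b [s' [e av bv]]]]]; [by left | right].
  exists a, b, (Rnn0 :: s'); split=> //.
  apply: perm_trans (perm_skip Rnn0 e) _.
  apply: perm_trans (perm_swap _ _ _) _.
  by apply: perm_skip; exact: perm_swap.
rewrite /is_tract; do !split.
- by move=> a b c; apply: Rnn_eq; rewrite /= Rmult_assoc.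
- by move=> a b; apply: Rnn_eq; rewrite /= Rmult_comm.
- by move=> a; apply: Rnn_eq; rewrite /= Rmult_1_l.
- by move=> a; apply: Rnn_eq; rewrite /= Rmult_0_l.
- by move=> /(congr1 (@proj1_sig _ _)) /=; lra.
- move=> a b a0 b0 /(congr1 (@proj1_sig _ _)) /= /Rmult_integral[] e.
    by apply: a0; exact: Rnn_eq.
  by apply: b0; exact: Rnn_eq.
- move=> a a0; have a1 : sval a <> 0%R by move=> e; apply: a0; exact: Rnn_eq.
  have ge : (0 <= / sval a)%R.
    by apply/Rlt_le/Rinv_0_lt_compat; have := Rnn_ge0 a; lra.
  by exists (exist _ _ ge); apply: Rnn_eq; rewrite /= Rinv_r.
- by left.
- exact: trop_perm.
- by move=> /t0.
- by move=> /t0.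
- exact: trop_cat.
- move=> s t hs; elim: t => [|y t ih]; first by left.
  by apply: trop_cat => //; exact: trop_scale.
- move=> h; apply: Rnn_eq; case: h.
    by move=> h; rewrite /= (h b) ?(h a) //=; auto.
  by case=> -[|[|p]] [[|[|q]]] [] //= pq _ _ ->.
- move=> -> /=; right; exists 0, 1; split=> //= x.
  by case=> [<-|[<-|]] //; exact: Rle_refl.
Qed.

Lemma mem_In (T : eqType) (x : T) s : List.In x s <-> x \in s.
Proof.
elim: s => //= y s ih; rewrite inE; split.
  by case=> [->|/ih ->]; rewrite ?eqxx ?orbT.
by case/orP=> [/eqP ->|/ih]; [left | right].
Qed.

Lemma Rargmax (T : eqType) (f : T -> R) (s : seq T) x0 : x0 \in s ->
  exists2 c, c \in s & forall e, e \in s -> (f e <= f c)%R.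
Proof.
elim: s x0 => // x s ih _ _; case: s ih => [|y s] ih.
  exists x; first exact: mem_head.
  by move=> e; rewrite inE => /eqP ->; exact: Rle_refl.
have [c cs hc] := ih y (mem_head _ _).
case: (Rle_or_lt (f x) (f c)) => h.
  exists c; first by rewrite inE cs orbT.
  by move=> e; rewrite inE => /orP[/eqP ->|/hc].
exists x; first exact: mem_head.
move=> e; rewrite inE => /orP[/eqP ->|/hc he]; first exact: Rle_refl.
lra.
Qed.

(** The maximum is attained at two positions, and at least one of them is not [c]. *)
Lemma trop_null_max2 m (h : 'I_m -> Rnn) c : trop_null [seq h e | e <- enum 'I_m] ->
  (0 < sval (h c))%R -> exists2 e, e != c & (sval (h c) <= sval (h e))%R.
Proof.
have cin : List.In (h c) [seq h e | e <- enum 'I_m].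
  by apply/List.in_map_iff; exists c; split=> //; apply/mem_In; rewrite mem_enum.
case=> [/(_ _ cin) -> |[p [q []]]]; first by lra.
rewrite size_map => pq ps qs E /(_ _ cin); move: E.
rewrite (nth_map c _ _ ps) (nth_map c _ _ qs) => E le _.
have ne : nth c (enum 'I_m) p != nth c (enum 'I_m) q.
  by rewrite nth_uniq ?enum_uniq //; apply/eqP.
case: (eqVneq (nth c (enum 'I_m) q) c) => [qc|]; last first.
  by exists (nth c (enum 'I_m) q) => //; rewrite -E.
by exists (nth c (enum 'I_m) p); [rewrite -[X in _ != X]qc | exact: le].
Qed.

Lemma trop_unique_max m (h : 'I_m -> Rnn) : ~ trop_null [seq h e | e <- enum 'I_m] ->
  exists2 c, (0 < sval (h c))%R & forall e, e != c -> (sval (h e) < sval (h c))%R.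
Proof.
move=> nh; have [c0 hc0] : exists c0, (0 < sval (h c0))%R.
  apply: NNPP => n; apply: nh; left=> x /List.in_map_iff [e [<- _]].
  have := Rnn_ge0 (h e); case: (Rlt_or_le 0 (sval (h e))) => [lt|]; last by lra.
  by case: n; exists e.
have [c _ hc] := @Rargmax _ (fun e => sval (h e)) (enum 'I_m) c0 (mem_enum _ _).
exists c; first by have := hc c0 (mem_enum _ _); lra.
move=> e ec; case: (Rlt_or_le (sval (h e)) (sval (h c))) => // le.
have E : sval (h e) = sval (h c) by have := hc e (mem_enum _ _); lra.
have ein d : d \in enum 'I_m by rewrite mem_enum.
have hd d : nth Rnn0 [seq h e | e <- enum 'I_m] (index d (enum 'I_m)) = h d.
  by rewrite (nth_map d) ?index_mem // nth_index.
case: nh; right; exists (index c (enum 'I_m)), (index e (enum 'I_m)).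
rewrite size_map !index_mem !hd E; split=> //.
  move=> i; case/eqP: ec.
  apply: etrans (esym (nth_index c (ein e))) (etrans _ (nth_index c (ein c))).
  by congr nth; exact: esym.
by move=> x /List.in_map_iff [d [<- _]]; apply: hc; rewrite mem_enum.
Qed.

Lemma trop_null3 (u v w : Rnn) : trop_null [:: u; v; w] ->
  (sval w <= sval u \/ sval w <= sval v)%R.
Proof.
case=> [h|[p [q [pq ps qs e h]]]].
  by left; rewrite (h u) ?(h w) /=; auto; lra.
have := h w (or_intror (or_intror (or_introl erefl))); move: pq ps qs e.
case: p {h} => [|[|[|p]]] //=; [by left | by right |].
by case: q => [|[|[|q]]] //= _ _ _ ->; [left | right].
Qed.

(** Let [c] be the strict maximum of [X e *' Y e], and let [a] maximise [psi e c / X e] over the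
    support of [X]. If [psi a c] is zero, then [c] is a loop. Otherwise the vector relation at [a]
    supplies a competitor [e] of [c], and the covector relation on [a], [e], [c] makes [X e *' Y e]
    at least as large as [X c *' Y c]. *)
Lemma tropical_rank2_perfect : rank2_perfect Tropical.
Proof.
have HF := tropical_tract.
move=> m psi X Y P [a0 [b0 ab0]]; apply: NNPP => nXY; apply: ab0.
have [c hc maxc] := trop_unique_max nXY.
have pos (x : Rnn) : x <> tzero Tropical -> (0 < sval x)%R.
  move=> h; have := Rnn_ge0 x; case: (Req_dec (sval x) 0) => [e|]; last by lra.
  by case: h; exact: Rnn_eq.
have Xc : X c <> tzero Tropical.
  by move=> e; move: hc; rewrite /= e /= Rmult_0_l; lra.
apply: (psi_eq0_of_loop HF P Xc).
have off l : X l = tzero Tropical -> psi l c = tzero Tropical.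
  exact: (psi_eq0_off_support HF P nXY).
pose f e := (sval (psi e c) / sval (X e))%R.
have [|a aX maxa] := @Rargmax _ f [seq e <- enum 'I_m | nz (X e)] c.
  by rewrite mem_filter mem_enum andbT; apply/nzP.
have Xa : X a <> tzero Tropical by move: aX; rewrite mem_filter => /andP[/nzP].
case: (classic (psi a c = tzero Tropical)) => [pac l|/pos pac].
  case: (classic (X l = tzero Tropical)) => [/off //|Xl].
  have := maxa l; rewrite mem_filter mem_enum andbT /f pac => /(_ (introT (nzP _) Xl)).
  rewrite /= /Rdiv Rmult_0_l => h; apply: NNPP => /pos plc.
  have := Rinv_0_lt_compat _ (pos _ Xl) => i.
  by have := Rmult_lt_0_compat _ _ plc i; lra.
have Yc : (0 < sval (Y c))%R.
  by apply: pos => e; move: hc; rewrite /= e /= Rmult_0_r; lra.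
have [|e ec] := @trop_null_max2 _ (fun e => tmul (Y e) (psi a e) : Tropical) c (vector1 P a).
  exact: Rmult_lt_0_compat.
(* [X c *' psi a e] is bounded by one of the other two terms of the covector relation; the choice of
   [a] bounds [X a *' psi e c] by [X e *' psi a c], so both cases agree. *)
have key : (sval (X c) * sval (psi a e) <= sval (X e) * sval (psi a c))%R.
  case: (eqVneq e a) => [->|ea].
    rewrite (psi_diag P) /= Rmult_0_r.
    by apply: Rmult_le_pos; exact: Rnn_ge0.
  have ac : a != c.
    by apply/eqP => ac; move: pac; rewrite ac (psi_diag P) /=; lra.
  have := covector3 P a e c.
  rewrite /= !inE negb_or [a == e]eq_sym ea ac ec => /(_ isT)/trop_null3[] //=.
  move=> le; apply: Rle_trans le _.
  case: (classic (X e = tzero Tropical)) => [Xe|Xe].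
    by rewrite off // Xe /= Rmult_0_r Rmult_0_l; lra.
  have := maxa e; rewrite mem_filter mem_enum andbT /f => /(_ (introT (nzP _) Xe)).
  have xa := pos _ Xa; have xe := pos _ Xe => h.
  have h1 : (sval (X a) * sval (X e) > 0)%R by apply: Rmult_lt_0_compat.
  have := Rmult_le_compat_l _ _ _ (Rlt_le _ _ h1) h.
  by congr (_ <= _)%R; field; lra.
have lt := maxc e ec; move=> /= le.
have xc := pos _ Xc.
have h1 : (sval (Y e) * (sval (X c) * sval (psi a e)) <=
    sval (Y e) * (sval (X e) * sval (psi a c)))%R.
  by apply: Rmult_le_compat_l => //; exact: Rnn_ge0.
have h2 : (sval (X e) * sval (Y e) * sval (psi a c) <
    sval (X c) * sval (Y c) * sval (psi a c))%R.
  exact: Rmult_lt_compat_r.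
have h3 : (sval (X c) * (sval (Y c) * sval (psi a c)) <=
    sval (X c) * (sval (Y e) * sval (psi a e)))%R.
  by apply: Rmult_le_compat_l => //; exact: Rlt_le.
lra.
Qed.

(** * Signs of reorderings *)

Section ListSigns.
Variable m : nat.
Implicit Types (l p q t : seq 'I_m) (x y : 'I_m).

(* Parity of the number of inversions. *)
Fixpoint inv l : bool :=
  if l is x :: l' then odd (count (fun y : 'I_m => y < x) l') (+) inv l' else false.

(** The inversions between [p] and what follows depend only on the multiset that follows. *)
Lemma inv_cat_perm p t t' : perm_eq t t' -> inv (p ++ t') = inv (p ++ t) (+) (inv t (+) inv t').
Proof.
move=> e; elim: p => [|x p ih] /=; first by rewrite addbA addbb.
by rewrite ih !count_cat (permP e) addbA.
Qed.

Lemma inv_swap p x y q : x != y -> inv (p ++ x :: y :: q) = ~~ inv (p ++ y :: x :: q).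
Proof.
move=> xy; rewrite (@inv_cat_perm p (y :: x :: q)) /=; last first.
  by apply/permP => P /=; lia.
have : (x < y) = ~~ (y < x) by rewrite ltnNge leq_eqVlt (negPf (_ : y != x :> nat)) // eq_sym.
rewrite !oddD !oddb => ->.
by case: (y < x); case: (odd _); case: (odd _); case: (inv q); case: (inv _).
Qed.

Lemma inv_move p y q t : y \notin q ->
  inv (p ++ y :: q ++ t) = odd (size q) (+) inv (p ++ q ++ y :: t).
Proof.
elim: q p => //= x q ih p; rewrite inE negb_or => /andP[yx yq].
by rewrite inv_swap // -cat_rcons ih // !cat_rcons addNb.
Qed.

(** Each of [b] and [c] crosses [p] once, and the two equal signs cancel. *)
Lemma inv_front2 b c p t : b \notin p -> c \notin p ->
  inv (b :: c :: p ++ t) = inv (p ++ b :: c :: t).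
Proof.
move=> bx cx; rewrite (@inv_move [:: b] c p t) // (@inv_move [::] b p (c :: t)) //.
by rewrite addbA addbb.
Qed.

Lemma count_lt_enum x l : perm_eq (x :: l) (enum 'I_m) -> count (fun y : 'I_m => y < x) l = x.
Proof.
move=> /permP/(_ (fun y : 'I_m => y < x)); rewrite /= ltnn add0n => ->.
rewrite -(count_map val (fun k => k < x)) val_enum_ord -size_filter.
by have := @filter_iota_ltn 0 m x (ltnW (ltn_ord x)); rewrite add0n => ->; rewrite size_iota.
Qed.

Lemma inv_cons_enum x l : perm_eq (x :: l) (enum 'I_m) -> inv (x :: l) = odd x (+) inv l.
Proof. by move=> /= /count_lt_enum ->. Qed.

Lemma inv_filter_enum (P : pred 'I_m) : inv (filter P (enum 'I_m)) = false.
Proof.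
have : sorted (relpre val ltn) (filter P (enum 'I_m)).
  apply: sorted_filter; first by move=> y x z /=; exact: ltn_trans.
  by rewrite -sorted_map val_enum_ord iota_ltn_sorted.
elim: (filter P _) => //= x l ih; rewrite path_sortedE; last first.
  by move=> ? ? ? /=; exact: ltn_trans.
case/andP=> h /ih ->; rewrite addbF.
have -> : count (fun y : 'I_m => y < x) l = 0; last by [].
apply/eqP; rewrite -leqn0 leqNgt -has_count; apply/hasPn => y /(allP h) /= lt.
by rewrite -leqNgt ltnW.
Qed.

End ListSigns.

Lemma perm_enum_neq m (k : 'I_m) : perm_eq (k :: [seq x <- enum 'I_m | x != k]) (enum 'I_m).
Proof.
apply: uniq_perm; rewrite ?enum_uniq //=.
  by rewrite mem_filter eqxx filter_uniq // enum_uniq.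
by move=> x; rewrite inE mem_filter mem_enum andbT orbN.
Qed.

Lemma perm_enum_lift m (a : 'I_m.+1) :
  perm_eq (a :: [seq lift a k | k <- enum 'I_m]) (enum 'I_m.+1).
Proof.
apply: uniq_perm; rewrite ?enum_uniq //=.
  rewrite map_inj_uniq ?enum_uniq ?andbT; last exact: lift_inj.
  by apply/mapP => -[k _ ak]; have := neq_lift a k; rewrite -ak eqxx.
move=> x; rewrite inE mem_enum; case: (unliftP a x) => [k ->|->]; last by rewrite eqxx.
by rewrite map_f ?mem_enum // orbT.
Qed.

Lemma inv_map_lift m (a : 'I_m.+1) (l : seq 'I_m) : inv [seq lift a x | x <- l] = inv l.
Proof.
elim: l => //= x l ->; rewrite count_map; congr (odd _ (+) _).
apply: eq_count => y /=; rewrite /bump; lia.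
Qed.

(** Adjacent transpositions generate all permutations. The length [N] is fixed because alternation
    of [rho] is known only on lists of length [rbar J]; the induction carries a prefix for the
    context of each swap. *)
Lemma swap_perm (T : eqType) (A : Type) (G : seq T -> A) N :
  (forall p x y q, x != y -> size (p ++ x :: y :: q) = N ->
     G (p ++ x :: y :: q) = G (p ++ y :: x :: q)) ->
  forall l l', size l = N -> perm_eq l l' -> G l = G l'.
Proof.
move=> sw l l' sl /perm_eq_Permutation e; rewrite -[l]cat0s -[l']cat0s.
have : size ([::] ++ l) = N by [].
elim: e [::] => //= {l l' sl}.
- by move=> x l l' _ ih p sz; rewrite -!cat_rcons ih // cat_rcons.
- by move=> x y l p sz; case: (eqVneq y x) => [->//|yx]; exact: sw.
- move=> l l' l'' e ih _ ih' p sz; rewrite ih // ih' //.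
  have es : size l' = size l := esym (Permutation_length e).
  by rewrite size_cat es -size_cat.
Qed.

(** * The inductive step for the Plücker relations of a weak representation *)

Section Representation.
Variables (F : tract_data) (HF : is_tract F) (n r : nat).
Variables (J : {set {ffun 'I_n -> 'I_r.+1}}) (MJ : Mconvex J).
Variables (rho : seq 'I_n -> F) (W : weak_rep J rho).

Lemma inJbar_count u u' : (forall e, count_mem e u = count_mem e u') ->
  inJbar J u -> inJbar J u'.
Proof.
move=> h /existsP[a /andP[aJ /forallP ha]]; apply/existsP; exists a; rewrite aJ /=.
by apply/forallP => e; rewrite -h.
Qed.

(** The exchange property for lists, after cancelling [dmin]: one [k] of [u] is replaced by [j]. The
    result [u'] is described by multiplicities, which leaves its order free. *)
Lemma inJbar_exchange u v j : inJbar J u -> inJbar J v -> count_mem j u < count_mem j v ->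
  exists2 k, count_mem k v < count_mem k u &
    forall u', (forall e, count_mem e u' + (e == k) = count_mem e u + (e == j)) -> inJbar J u'.
Proof.
move=> /existsP[b /andP[bJ /forallP hb]] /existsP[a /andP[aJ /forallP ha]] lt.
have [|k [akbk _ [b' b'J hb']]] := (and3_rect (fun _ _ h => h) MJ) a b j aJ bJ.
  by rewrite (eqP (ha j)) (eqP (hb j)) ltn_add2r.
exists k; first by move: akbk; rewrite (eqP (ha k)) (eqP (hb k)) ltn_add2r.
move=> u' hu; apply/existsP; exists b'; rewrite b'J; apply/forallP => e.
have := hu e; have := hb' e; rewrite (eqP (hb e)) => h1 h2.
by apply/eqP/(@addIn (e == k)); rewrite h1 [RHS]addnAC h2 addnAC.
Qed.

Lemma rho_swap p x y q : size (p ++ x :: y :: q) = rbar J ->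
  rho (p ++ x :: y :: q) = -' rho (p ++ y :: x :: q).
Proof. by case: W => alt _ _; exact: (alt p x [::] y q). Qed.

Lemma rho_move p y q t : size (p ++ y :: q ++ t) = rbar J ->
  rho (p ++ y :: q ++ t) = sg (odd (size q)) (rho (p ++ q ++ y :: t)).
Proof.
elim: q p => //= x q ih p sz.
rewrite rho_swap // -cat_rcons ih ?cat_rcons; last first.
  by rewrite -sz !size_cat /= !size_cat.
by rewrite sg_opp.
Qed.

Lemma rho_neq0 u : size u = rbar J -> inJbar J u -> rho u <> tzero F.
Proof. by case: W => _ h _ /h h' /h'. Qed.

Lemma inJbar_rho u : size u = rbar J -> rho u <> tzero F -> inJbar J u.
Proof. by case: W => _ h _ /h h' /h'. Qed.

Lemma le_omega_sub u v : (forall e, count_mem e u <= count_mem e v) ->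
  le_omega J v -> le_omega J u.
Proof. by move=> h hv e; exact: leq_trans (h e) (hv e). Qed.

Definition gp_relation (s : nat) (alpha : seq 'I_n) (i : 'I_s.+1 -> 'I_n) (js : seq 'I_n) :=
  tnull F [seq tsign k
             (tmul (rho (alpha ++ [seq i m | m <- enum 'I_s.+1 & m != k]))
                   (rho (alpha ++ i k :: js)))
          | k : 'I_s.+1 <- enum 'I_s.+1].

Section Step.
Variables (s : nat) (alpha : seq 'I_n) (i : 'I_s.+2 -> 'I_n) (j2 : 'I_n) (js : seq 'I_n).
Hypothesis s_gt0 : 0 < s.
Hypothesis size_alpha : size alpha + s.+1 = rbar J.
Hypothesis size_js : size js = s.-1.
Hypothesis le_om : le_omega J (alpha ++ [seq i m | m <- enum 'I_s.+2] ++ j2 :: js).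
Hypothesis IH : forall a : 'I_s.+2,
  gp_relation (alpha ++ [:: j2]) (fun k : 'I_s.+1 => i (lift a k)) js.

Notation zero := (tzero F).
Notation full := (enum 'I_s.+2).

Let f (l : seq 'I_s.+2) := rho (alpha ++ [seq i x | x <- l]).
Let g (l : seq 'I_s.+2) := rho (alpha ++ j2 :: [seq i x | x <- l]).
Let rest (l : seq 'I_s.+2) := [seq z <- full | z \notin l].
(** The sign is that of the ordering formed by [a] and then its complement, as for a Hodge dual.
    [XE] and [psiE] show that the complement may be listed in any order. *)
Let X a := sg (inv (a :: rest [:: a])) (f (rest [:: a])).
Let psi a b := if a == b then zero else sg (inv (a :: b :: rest [:: a; b])) (g (rest [:: a; b])).
Let Y e := rho (alpha ++ i e :: j2 :: js).

Lemma perm_rest l : uniq l -> perm_eq (l ++ rest l) full.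
Proof.
move=> ul; apply: uniq_perm; last 2 first.
- exact: enum_uniq.
- by move=> x; rewrite mem_cat mem_filter mem_enum andbT orbN.
rewrite cat_uniq ul filter_uniq ?enum_uniq // andbT.
by apply/hasPn => x; rewrite mem_filter => /andP[].
Qed.

Lemma size_full l : perm_eq l full -> size l = s.+2.
Proof. by move/perm_size; rewrite size_enum_ord. Qed.

(** An adjacent swap in the complement changes both the sign and [rho], so their product is
    invariant. *)
Lemma XE a l : perm_eq (a :: l) full -> X a = sg (inv (a :: l)) (f l).
Proof.
move=> e; have e' := @perm_rest [:: a] isT.
apply: (@swap_perm _ _ (fun l => sg (inv (a :: l)) (f l)) s.+1 _ (rest [:: a]) l); last first.
- by rewrite -(perm_cons a); rewrite (permPl e') perm_sym.
- by have := size_full e' => -[].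
move=> p x y q xy sz; rewrite -!cat_cons inv_swap // /f !map_cat !map_cons !catA rho_swap.
  by case: (inv _); rewrite /sg /negb ?tnegK.
by move: sz; rewrite -size_alpha !size_cat /= !size_map; lia.
Qed.

Lemma psiE a b l : perm_eq (a :: b :: l) full -> psi a b = sg (inv (a :: b :: l)) (g l).
Proof.
move=> e; have ab : a != b.
  by have := perm_uniq e; rewrite enum_uniq /= !inE; case: eqP.
have e' := @perm_rest [:: a; b].
rewrite /= inE ab in e'; have {}e' := e' isT.
rewrite /psi (negPf ab).
apply: (@swap_perm _ _ (fun l => sg (inv (a :: b :: l)) (g l)) s _ (rest [:: a; b]) l); last first.
- by rewrite -(perm_cons b) -(perm_cons a); rewrite (permPl e') perm_sym.
- by have := size_full e' => -[].
move=> p x y q xy sz; rewrite -!cat_cons inv_swap // /g !map_cat !map_cons.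
rewrite -!cat_cons !catA rho_swap.
  by case: (inv _); rewrite /sg /negb ?tnegK.
by move: sz; rewrite -size_alpha !size_cat /= ?size_cat /= !size_map; lia.
Qed.

Lemma count_full u l e : perm_eq (u ++ l) full ->
  count_mem e [seq i m | m <- full] =
  count_mem e [seq i m | m <- u] + count_mem e [seq i m | m <- l].
Proof. by move=> h; rewrite -count_cat -map_cat; apply/esym/permP/perm_map. Qed.

Lemma psi_swap a b : psi b a = -' psi a b.
Proof.
case: (eqVneq a b) => [->|ab]; first by rewrite /psi eqxx tneg0.
have e := @perm_rest [:: a; b]; rewrite /= inE ab in e; have {}e := e isT.
rewrite (psiE e) (@psiE b a (rest [:: a; b])) ?sg_opp //.
  by rewrite (@inv_swap _ [::] b a) // eq_sym.
by rewrite -(permPr e); apply/permP => q /=; lia.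
Qed.

Lemma psi_3term a b c d : uniq [:: a; b; c; d] ->
  tnull F [:: psi b c *' psi a d; -' (psi a c *' psi b d); psi a b *' psi c d].
Proof.
move=> u; have := perm_rest u; set x := rest _ => e.
have nx y : y \in [:: a; b; c; d] -> y \notin x by rewrite mem_filter => ->.
(* The complement of one pair is [x] with the other pair. The two orderings of the four indices
   differ by moving a pair past a pair, an even permutation, so the two signs cancel. *)
have term b1 c1 a1 d1 : perm_eq [:: b1; c1; a1; d1] [:: a; b; c; d] ->
    psi b1 c1 *' psi a1 d1 = g (x ++ [:: b1; c1]) *' g (x ++ [:: a1; d1]).
  move=> h; have u1 : uniq [:: b1; c1; a1; d1] by rewrite (perm_uniq h).
  have nx1 y : y \in [:: b1; c1; a1; d1] -> y \notin x by rewrite (perm_mem h); exact: nx.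
  have e1 : perm_eq ([:: b1; c1; a1; d1] ++ x) full by rewrite -(permPr e) perm_cat2r.
  rewrite (@psiE b1 c1 (x ++ [:: a1; d1])); last first.
    by rewrite -(permPr e1) !perm_cons perm_catC.
  rewrite (@psiE a1 d1 (x ++ [:: b1; c1])); last first.
    by rewrite -(permPr e1); apply: (permEl (perm_catC ([:: a1; d1] ++ x) [:: b1; c1])).
  rewrite !inv_front2 ?nx1 ?inE ?eqxx ?orbT //.
  rewrite (@inv_cat_perm _ x [:: a1; d1; b1; c1] [:: b1; c1; a1; d1]); last first.
    exact: (permEl (perm_catC [:: a1; d1] [:: b1; c1])).
  have [nb nc] : b1 \notin [:: a1; d1] /\ c1 \notin [:: a1; d1].
    by move: u1; rewrite /= !inE !negb_or => /andP[/andP[_ ->] /andP[->]].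
  have -> : inv [:: a1; d1; b1; c1] = inv [:: b1; c1; a1; d1].
    by rewrite (@inv_front2 _ b1 c1 [:: a1; d1] [::]).
  by rewrite addbb addbF sgM // sgMr // sg_sg // addbb tmulC.
rewrite (term b c a d) ?(term a c b d) ?(term a b c d) //; try by apply/permP => q /=; lia.
have [_ _ w3] := W.
have := w3 (alpha ++ j2 :: [seq i z | z <- x]) (i a) (i b) (i c) (i d).
have gE y z : g (x ++ [:: y; z]) = rho ((alpha ++ j2 :: [seq i z | z <- x]) ++ [:: i y; i z]).
  by rewrite /g map_cat -catA.
rewrite !gE; apply.
  by move: (size_full e); rewrite -size_alpha !size_cat /= size_map; lia.
apply: le_omega_sub le_om => y.
rewrite !count_cat /= (@count_full [:: a; b; c; d] x) // /=; lia.
Qed.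

Lemma covector_3term a b c : uniq [:: a; b; c] ->
  tnull F [:: X a *' psi b c; -' (X b *' psi a c); X c *' psi a b].
Proof.
move=> u; have := perm_rest u; set x := rest _ => e.
have nx y : y \in [:: a; b; c] -> y \notin x by rewrite mem_filter => ->.
have se := size_full e.
pose al := alpha ++ [seq i z | z <- x].
(* Each product has the same total sign: moving [a1] past [x] and moving [j2] past [x] and [a1]
   leave a factor of -1. What remains is a three-term relation of [rho] at [al] on [i a], [i b],
   [i c], [j2]. *)
have term a1 b1 c1 : perm_eq [:: a1; b1; c1] [:: a; b; c] ->
    X a1 *' psi b1 c1 = -' (rho (al ++ [:: i b1; i c1]) *' rho (al ++ [:: i a1; j2])).
  move=> h; have u1 : uniq [:: a1; b1; c1] by rewrite (perm_uniq h).
  have nx1 y : y \in [:: a1; b1; c1] -> y \notin x by rewrite (perm_mem h); exact: nx.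
  have e1 : perm_eq ([:: a1; b1; c1] ++ x) full by rewrite -(permPr e) perm_cat2r.
  rewrite (@XE a1 (x ++ [:: b1; c1])); last first.
    by rewrite -(permPr e1) !perm_cons perm_catC.
  rewrite (@psiE b1 c1 (x ++ [:: a1])); last first.
    by rewrite -(permPr e1); apply: (permEl (perm_catC ([:: b1; c1] ++ x) [:: a1])).
  have -> : inv (a1 :: x ++ [:: b1; c1]) = odd (size x) (+) inv (x ++ [:: a1; b1; c1]).
    by apply: (@inv_move _ [::] a1 x); rewrite nx1 ?inE ?eqxx.
  rewrite inv_front2 ?nx1 ?inE ?eqxx ?orbT //.
  have -> : inv (x ++ [:: b1; c1; a1]) = inv (x ++ [:: a1; b1; c1]).
    rewrite (@inv_cat_perm _ x [:: a1; b1; c1]); last first.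
      exact: (permEl (perm_catC [:: a1] [:: b1; c1])).
    rewrite (@inv_move _ [::] a1 [:: b1; c1] [::]) ?addbb ?addbF //.
    by case/andP: u1.
  have -> : g (x ++ [:: a1]) = sg (odd (size x).+1) (rho (al ++ [:: i a1; j2])).
    rewrite /g map_cat -[_ ++ [seq i z | z <- [:: a1]]]cats0 rho_move ?cats0.
      by rewrite size_cat size_map addn1 /al -!catA.
    by move: se; rewrite -size_alpha !size_cat /= !size_cat /= size_map; lia.
  have -> : f (x ++ [:: b1; c1]) = rho (al ++ [:: i b1; i c1]) by rewrite /f map_cat catA.
  rewrite sgM // !sgMr // !sg_sg //=.
  by case: (odd _); case: (inv _).
rewrite (term a b c) // (term b a c) ?(term c a b); try by apply/permP => q /=; lia.
have [_ _ w3] := W.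
have := w3 al (i a) (i b) (i c) j2.
move=> h; apply/(null_opp HF) => /=; rewrite !tnegK //; apply: h.
  by move: se; rewrite -size_alpha /al !size_cat /= size_map; lia.
apply: le_omega_sub le_om => y.
rewrite !count_cat /= (@count_full [:: a; b; c] x) // /=; lia.
Qed.

Lemma vector_relation a : tnull F [seq Y e *' psi a e | e <- full].
Proof.
have ea : perm_eq (a :: [seq lift a k | k <- enum 'I_s.+1]) full.
  exact: perm_enum_lift.
apply: (null_perm_map HF ea); rewrite /= {1}/psi eqxx tmulr0 //; apply/null0 => //.
(* The global sign has two sources: [a] in front of its complement contributes [odd a], and
   exchanging [j2] with [i e] contributes one more. *)
have := IH a; rewrite /gp_relation -map_comp => /(null_sg HF (~~ odd a)).
rewrite -map_comp; congr tnull; apply: eq_map => k /=.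
set l0 := [seq m <- enum 'I_s.+1 | m != k].
have e0 : perm_eq (k :: l0) (enum 'I_s.+1) by exact: perm_enum_neq.
have e1 : perm_eq (a :: lift a k :: [seq lift a m | m <- l0]) full.
  rewrite -(permPr ea) perm_cons; exact: (perm_map (lift a) e0).
rewrite (psiE e1) (inv_cons_enum e1).
rewrite -[lift a k :: _]/([seq lift a m | m <- k :: l0]) inv_map_lift (inv_cons_enum e0).
rewrite inv_filter_enum addbF tsignE // /g /Y -map_comp.
rewrite -/(sg (odd k) _) sg_sg //.
rewrite rho_swap; last first.
  by move: size_alpha size_js; rewrite !size_cat /=; lia.
rewrite tmulNl // sgMr // sg_opp // -!catA /= (tmulC HF).
by congr (sg _ _); rewrite addNb.
Qed.

Lemma step_pair : rank2_pair psi X Y.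
Proof.
split; [by move=> a; rewrite /psi eqxx | by move=> a b; exact: psi_swap | exact: psi_3term
 | exact: covector_3term | exact: vector_relation].
Qed.

(** Both factors being nonzero gives two members of [inJbar]. The aim is to replace some [i p] by
    [j2] in the first one, and [psi e p] is then nonzero. *)
Lemma step_nonzero e : X e *' Y e <> zero -> exists a b, psi a b <> zero.
Proof.
move=> XY.
have f0 : f (rest [:: e]) <> zero.
  by move=> h; apply: XY; rewrite /X h; case: inv; rewrite /= ?tneg0 // tmul0.
have Y0 : Y e <> zero by move=> h; apply: XY; rewrite h tmulr0.
have e1 := @perm_rest [:: e] isT; have s1 := size_full e1.
have Jf : inJbar J (alpha ++ [seq i x | x <- rest [:: e]]).
  by apply: inJbar_rho f0; move: s1; rewrite -size_alpha size_cat size_map /=; lia.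
have JY : inJbar J (alpha ++ i e :: j2 :: js).
  by apply: inJbar_rho Y0; rewrite -size_alpha size_cat /= size_js; lia.
have p0 p : p \in rest [:: e] ->
    perm_eq (p :: rest [:: e; p]) (rest [:: e]) /\
    (inJbar J (alpha ++ j2 :: [seq i x | x <- rest [:: e; p]]) -> psi e p <> zero).
  rewrite mem_filter inE eq_sym => /andP[ep _].
  have e2 : perm_eq (e :: p :: rest [:: e; p]) full.
    by apply: (@perm_rest [:: e; p]); rewrite /= inE ep.
  split; first by rewrite -(perm_cons e) (permPl e2) perm_sym.
  move=> h; rewrite (psiE e2) => /(sg_eq0 HF); apply: rho_neq0 h.
  by have := size_full e2; rewrite -size_alpha size_cat /= size_map; lia.
have cnt p y : perm_eq (p :: rest [:: e; p]) (rest [:: e]) ->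
    count_mem y [seq i x | x <- rest [:: e]] =
    (i p == y) + count_mem y [seq i x | x <- rest [:: e; p]].
  by move=> h; rewrite -[RHS]/(count_mem y [seq i x | x <- p :: rest [:: e; p]]);
    apply/esym/permP/perm_map.
exists e; case: (ltnP (count_mem j2 (alpha ++ [seq i x | x <- rest [:: e]]))
                      (count_mem j2 (alpha ++ i e :: j2 :: js))) => lt.
  have [k] := inJbar_exchange Jf JY lt; rewrite !count_cat /= => lt' h.
  (* The prefix [alpha] is common to both lists, so the surplus of [k] comes from the indexed
     entries. *)
  have : k \in [seq i x | x <- rest [:: e]].
    rewrite -has_pred1 has_count -(ltn_add2l (count_mem k alpha)) addn0.
    exact: leq_ltn_trans (leq_addr _ _) lt'.
  case/mapP => p pr kp; have [pp hp] := p0 p pr; exists p; apply: hp.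
  apply: h => y; rewrite !count_cat /= (cnt p y pp) kp ![_ == y]eq_sym -!addnA.
  by congr (_ + _); rewrite addnA addnC [_ + count _ _]addnC.
(* Otherwise [j2] already occurs among the indexed entries, and trading it for itself changes no
   multiplicity. *)
have : j2 \in [seq i x | x <- rest [:: e]].
  rewrite -has_pred1 has_count -(ltn_add2l (count_mem j2 alpha)) addn0.
  move: lt; rewrite !count_cat /= eqxx; apply: leq_trans.
  by rewrite -[X in X < _]addn0 ltn_add2l addn_gt0 orbT.
case/mapP => p pr kp; have [pp hp] := p0 p pr; exists p; apply: hp.
apply: inJbar_count Jf => y.
by rewrite !count_cat /= (cnt p y pp) kp.
Qed.

Lemma gp_step : rank2_perfect F -> gp_relation alpha i (j2 :: js).
Proof.
move=> H2.
have : tnull F [seq X k *' Y k | k <- full].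
  case: (classic (exists e, X e *' Y e <> zero)) => [[e /step_nonzero]|no].
    exact: H2 step_pair.
  by apply: null_all0 => // e; apply: NNPP => h; apply: no; exists e.
rewrite /gp_relation; congr tnull; apply: eq_map => k.
have e : perm_eq (k :: [seq m <- full | m != k]) full by exact: perm_enum_neq.
by rewrite (XE e) (inv_cons_enum e) inv_filter_enum addbF tsignE // sgM.
Qed.

End Step.
End Representation.

(** * From rank 2 orthogonality to excellence *)

Lemma rank2_perfect_excellent (F : tract_data) : is_tract F -> rank2_perfect F -> excellent F.
Proof.
move=> HF H2 n r J MJ rho W; split=> // s alpha i js /andP[s2 _].
(* The induction starts at [s = 1], one below the range of [strong_rep]; there the relation has two
   opposite terms and holds by commutativity. *)
have {s2} : 0 < s by apply: leq_trans s2.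
elim: s alpha i js => // s ih alpha i js _ sz.
case: s ih i sz => [|s] ih i sz; case: js => [|j2 js] //=.
  move=> _ _; rewrite !enum_ordSl enum_ord0 /=.
  by apply/(null2 HF); rewrite (tmulC HF).
move=> [sj] le; apply: (gp_step HF MJ W) => // a.
apply: ih => //; first by rewrite size_cat /=; lia.
apply: le_omega_sub le => y; rewrite !count_cat /=.
(* Passing to [alpha ++ [:: j2]] and omitting the index [a] only lowers multiplicities, so the bound
   by [omega] persists. *)
have /permP/(_ (pred1 y)) := perm_map i (perm_enum_lift a).
rewrite /= -map_comp => <-; rewrite !addnA addn0 leq_add2r addnAC leq_add2r.
rewrite -addnA leq_add2l; exact: leq_addl.
Qed.

(** * The Krasner hyperfield and the conclusion *)

Lemma krasner_tract : is_tract Krasner.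
Proof.
pose K := count (fun b : bool => b).
have Kperm (s t : seq bool) : Permutation s t -> K s = K t.
  by rewrite /K; elim=> //= [x l l' _ -> | x y l | l l' l'' _ -> _ ->]; rewrite // addnCA.
(* The number of nonzero terms is multiplicative, and a product of naturals is 1 only if both
   factors are. *)
have Kscale (t s : seq bool) : K (allpairs andb t s) = K t * K s.
  elim: t => //= x t ih; rewrite [LHS]count_cat -/K ih mulnDl; congr (_ + _).
  by rewrite /K count_map; case: x; rewrite ?mul1n ?mul0n //; apply: count_pred0.
rewrite /is_tract; do !split => //.
- by move=> a b c; exact: andbA.
- by move=> a b; exact: andbC.
- by case=> [] [].
- by case=> // _; exists true.
- by move=> s t /Kperm; rewrite /K /= => ->.
- move=> s t /=; rewrite count_cat; case: (count _ s) => [|[|k]] //;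
    case: (count _ t) => [|[|l]] //= _ _; lia.
- by move=> s t /= h; rewrite -/(K _) Kscale muln_eq1 negb_and h orbT.
- by case: a; case: b.
- by move=> /= ->; case: a.
Qed.

Lemma krasner_degenerate : degenerate Krasner.
Proof.
move=> s h; rewrite /tnull /=; case: s h => [|x [|y s]] //= h _.
have -> : x = true by case: x h => // h; case: (h false (or_introl erefl)).
by have -> : y = true by case: y h => // h; case: (h false (or_intror (or_introl erefl))).
Qed.

Theorem theoremJ :
  (forall F : tract_data, is_tract F -> perfect F -> ~ near_idempotent F -> excellent F) /\
  (forall F : tract_data, is_tract F -> degenerate F -> excellent F) /\
  (excellent Krasner /\ excellent Tropical).
Proof.
split.
  move=> F HF perfF _; apply: rank2_perfect_excellent => //.
  exact: perfect_rank2_perfect.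
have deg F : is_tract F -> degenerate F -> excellent F.
  move=> HF dF; apply: rank2_perfect_excellent => //.
  exact: degenerate_rank2_perfect.
split=> //; split; first exact: deg krasner_tract krasner_degenerate.
exact: rank2_perfect_excellent tropical_tract tropical_rank2_perfect.
Qed.
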